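(* Let $\mathcal I\subset\mathbb R$ be an open interval, let $\mathcal X\subset\mathbb R^n$ and $\mathcal M\subset\mathbb R^m$ be open connected sets, let $t_0\in\mathcal I$, $x^0\in\mathcal X$, and let $f:\mathcal I\times\mathcal X\times\mathcal M\to\mathbb R^n$ satisfy: 1) $f$ is measurable on $\mathcal I\times\mathcal X\times\mathcal M$; 2) for every fixed $t\in\mathcal I$, $f$ is continuous in $(x,\mu)\in\mathcal X\times\mathcal M$; 3) there is a Lebesgue locally summable function $m$ on $\mathcal I$ such that $\|f(t,x,\mu)\|\le m(t)$ for all $t\in\mathcal I$ and $(x,\mu)\in\mathcal X\times\mathcal M$; 4) there is a constant $L$, independent of $t$ and $\mu$, such that for almost every $t\in\mathcal I$ and every $\mu\in\mathcal M$, $\|f(t,x',\mu)-f(t,x'',\mu)\|\le L\|x'-x''\|$ for all $x',x''\in\mathcal X$; 5) the family $\{f(t,x,\cdot)\}_{(t,x)\in\mathcal I\times\mathcal X}$ is equicontinuous on $\mathcal M$, i.e. for every $\varepsilon>0$ there is $\delta>0$ such that $\|f(t,x,\mu_1)-f(t,x,\mu_2)\|<\varepsilon$ for all $(t,x)\in\mathcal I\times\mathcal X$ and all $\mu_1,\mu_2\in\mathcal M$ with $\|\mu_1-\mu_2\|<\delta$. Let $[a,b]\subset\mathcal I$ be a closed interval with $t_0\in[a,b]$ such that for every $\mu\in\mathcal M$ the Cauchy problem $$\frac{dx}{dt}=f(t,x,\mu),\qquad x(t_0)=x^0$$ has a unique solution $x(t,\mu)$ on $[a,b]$. Then $x(t,\mu)$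 depends uniformly continuously on $\mu\in\mathcal M$, uniformly with respect to $t\in[a,b]$: for every $\varepsilon>0$ there is $\delta>0$ such that $\|x(t,\mu_1)-x(t,\mu_2)\|<\varepsilon$ for all $t\in[a,b]$ and all $\mu_1,\mu_2\in\mathcal M$ with $\|\mu_1-\mu_2\|<\delta$.
   Context: $\|\cdot\|$ denotes a norm on $\mathbb R^k$. A solution on $[a,b]$ is a function $[a,b]\to\mathcal X$, absolutely continuous in $t$, that satisfies the differential equation for almost every $t\in[a,b]$ and the initial condition. A classical theorem guarantees that, under conditions 1)--4), there exists a closed interval $[a,b]\subset\mathcal I$ on which for every $\mu\in\mathcal M$ the problem has a unique absolutely continuous solution, which depends continuously on $\mu$. *)

(* Defs.v *)
From mathcomp Require Import all_boot all_order all_algebra.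
From mathcomp Require Import all_classical all_reals all_analysis.

Set Implicit Arguments.
Unset Strict Implicit.
Unset Printing Implicit Defensive.

Import Order.TTheory GRing.Theory Num.Theory.
Import numFieldNormedType.Exports.

Local Open Scope classical_set_scope.
Local Open Scope ring_scope.

Record is_norm (R : realType) (k : nat) (N : 'rV[R]_k -> R) : Prop := IsNorm {
  is_norm_ge0 : forall x, 0 <= N x ;
  is_norm_eq0 : forall x, N x = 0 -> x = 0 ;
  is_normZ : forall (c : R) x, N (c *: x) = `|c| * N x ;
  is_normD : forall x y, N (x + y) <= N x + N y }.

(* Half-open boxes ]l, u]; the box is empty and its volume is 0 as soon as
   u 0 i <= l 0 i for some i. *)
Definition box (R : realType) (k : nat) (c : 'rV[R]_k * 'rV[R]_k) :
    set 'rV[R]_k :=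
  [set x | forall i, c.1 0 i < x 0 i <= c.2 0 i].

Definition box_volume (R : realType) (k : nat) (c : 'rV[R]_k * 'rV[R]_k) : R :=
  \prod_i Num.max 0 (c.2 0 i - c.1 0 i).

(* The dimension is a successor because covers are infinite sequences of boxes,
   and in dimension 0 there is no empty box to pad a finite cover with. *)
Definition lebesgue_outer (R : realType) (k : nat) (A : set 'rV[R]_k.+1) :
    \bar R :=
  ereal_inf [set (\sum_(j <oo) (box_volume (B j))%:E)%E
            | B in [set B : nat -> 'rV[R]_k.+1 * 'rV[R]_k.+1
                   | A `<=` \bigcup_j box (B j)]].

Definition lebesgue_measurable (R : realType) (k : nat)
    (A : set 'rV[R]_k.+1) : Prop :=
  caratheodory_measurable (@lebesgue_outer R k) A.

Definition join3 (R : realType) (n m : nat)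
    (p : R * 'rV[R]_n * 'rV[R]_m) : 'rV[R]_(n + m).+1 :=
  row_mx (p.1.1%:M : 'rV[R]_1) (row_mx p.1.2 p.2).

(* Lebesgue (not merely Borel) measurability of f on the subset I x X x M
   of R^(1 + n + m). *)
Definition jointly_measurable (R : realType) (n m : nat) (I : set R)
    (X : set 'rV[R]_n) (M : set 'rV[R]_m)
    (f : R -> 'rV[R]_n -> 'rV[R]_m -> 'rV[R]_n) : Prop :=
  forall U : set 'rV[R]_n, open U ->
    lebesgue_measurable
      (@join3 R n m @` [set p | [/\ I p.1.1, X p.1.2, M p.2 &
                                   U (f p.1.1 p.1.2 p.2)]]).

(* [locally_integrable] from the library requires Borel measurability; the
   completed measure gives Lebesgue measurability. *)
Definition locally_summable (R : realType) (I : set R) (g : R -> R) : Prop :=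
  forall K : set R, K `<=` I -> compact K ->
    (@completed_lebesgue_measure R).-integrable K (EFin \o g).

(* Stated with the sup norm of 'rV[R]_n; the notion does not depend on the
   norm. *)
Definition abs_continuous (R : realType) (n : nat) (a b : R)
    (x : R -> 'rV[R]_n) : Prop :=
  forall e : R, 0 < e -> exists2 d : R, 0 < d &
    forall (k : nat) (l u : 'I_k -> R),
      (forall i, [/\ a <= l i, l i <= u i & u i <= b]) ->
      trivIset [set: 'I_k] (fun i => `]l i, u i[%classic) ->
      \sum_i (u i - l i) < d ->
      \sum_i `|x (u i) - x (l i)| < e.

(* Only the values of x on [a, b] matter: the two-sided derivative looks outside
   [a, b] at the endpoints alone, which form a null set. *)
Definition is_solution (R : realType) (n : nat) (X : set 'rV[R]_n)
    (F : R -> 'rV[R]_n -> 'rV[R]_n) (t0 : R) (x0 : 'rV[R]_n) (a b : R)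
    (x : R -> 'rV[R]_n) : Prop :=
  [/\ (forall t, a <= t <= b -> X (x t)),
      abs_continuous a b x,
      {ae lebesgue_measure, forall t : R,
         a <= t <= b -> is_derive t 1 x (F t (x t))} &
      x t0 = x0].

(* Main.v *)
(* The difference u of two solutions satisfies |u'| <= L |u| + eta almost
   everywhere, where eta is the modulus of equicontinuity of f in mu. The mean
   value inequality for absolutely continuous functions on an interval of length
   1/(2L) then gives |u(q)| + eta/L <= 2 (|u(p)| + eta/L) at its endpoints, in
   either direction of time. Since u(t0) = 0, finitely many such steps, their
   number depending only on L and b - a, bound |u| on [a, b] by a constant
   multiple of eta. *)
Require Import Defs.
From mathcomp Require Import all_boot all_order all_algebra.
From mathcomp Require Import all_classical all_reals all_analysis.
From mathcomp Require Import lra ring.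
Import Order.TTheory GRing.Theory Num.Theory.
Import numFieldNormedType.Exports.
Local Open Scope classical_set_scope.
Local Open Scope ring_scope.

Set Implicit Arguments.
Unset Strict Implicit.

(** * Induction along a compact interval *)

(** Replaces the choice of a fine tagged partition. At the supremum [c] of the points reachable from
    [a], the local hypothesis joins a reachable point just before [c] to a point beyond [c], unless
    [c] is already [b]. *)
Lemma cousin (R : realType) (Q : R -> R -> Prop) (a b : R) :
  (forall r s t, a <= r -> r <= s -> s <= t -> t <= b ->
     Q r s -> Q s t -> Q r t) ->
  (forall t, a <= t <= b -> exists2 g, 0 < g &
     forall r s, a <= r -> r <= t -> t <= s -> s <= b ->
       t - g < r -> s < t + g -> Q r s) ->
  a <= b -> Q a b.
Proof.
move=> Qtrans Qloc ab.
pose S : set R := [set t | a <= t <= b /\ Q a t].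
have Sa : S a.
  split; first by rewrite lexx ab.
  have [|g g0 H] := Qloc a; first by rewrite lexx ab.
  by apply: H => //; lra.
have ubS : ubound S b by move=> t [/andP[]].
have hsS : has_sup S by split; [exists a | exists b].
pose c := sup S.
have ac : a <= c by apply: ub_le_sup => //; exists b.
have cb : c <= b by apply: ge_sup => //; exists a.
have [|g g0 H] := Qloc c; first by rewrite ac cb.
have [t [/andP[at_ tb] Qat] ct] := sup_adherent g0 hsS.
have tc : t <= c.
  apply: ub_le_sup; first by exists b.
  by split => //; rewrite at_.
pose s := Num.min b (c + g / 2).
have cs : c <= s by rewrite le_min cb; lra.
have sb : s <= b by rewrite ge_min lexx.
have sg : s <= c + g / 2 by rewrite ge_min lexx orbT.
have Qas : Q a s.
  apply: (Qtrans a t s) => //; first exact: le_trans tc cs.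
  by apply: H => //; rewrite -/c in ct; lra.
have sc : s <= c.
  apply: ub_le_sup; first by exists b.
  by split => //; rewrite sb (le_trans ac cs).
suff -> : b = s by [].
(* [s <= c] excludes [s = c + g / 2], so the minimum defining [s] is [b]. *)
apply/eqP; rewrite eq_le sb andbT.
move: sc; rewrite /s; case: (leP b (c + g/2)) => //; lra.
Qed.

(** * Norms and absolutely continuous functions *)

Lemma is_norm0 (R : realType) k (N : 'rV[R]_k -> R) : is_norm N -> N 0 = 0.
Proof. by move=> hN; rewrite -(scale0r 0) (is_normZ hN) normr0 mul0r. Qed.

Lemma is_normN (R : realType) k (N : 'rV[R]_k -> R) v : is_norm N -> N (- v) = N v.
Proof. by move=> hN; rewrite -scaleN1r (is_normZ hN) normrN normr1 mul1r. Qed.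

(** Expansion in the canonical basis. It carries derivatives and absolute continuity, both expressed
    in the sup norm, over to [N]. *)
Lemma is_norm_le_sup (R : realType) k (N : 'rV[R]_k -> R) : is_norm N ->
  exists2 C : R, 0 < C & forall v, N v <= C * `|v|.
Proof.
move=> hN; pose S := \sum_i N (delta_mx 0 i).
have S0 : 0 <= S by apply: sumr_ge0 => i _; exact: is_norm_ge0 hN _.
(* The summand 1 keeps the constant positive in dimension 0, where [S] is 0. *)
exists (1 + S) => [|v]; first lra.
have entry i : `|v 0 i| <= `|v|.
  rewrite /Num.norm/= mx_normrE.
  exact: (le_bigmax_cond _ (fun ij : 'I_1 * 'I_k => `|v ij.1 ij.2|) (j := (0, i))).
apply: (@le_trans _ _ (S * `|v|)); last by rewrite ler_wpM2r //; lra.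
rewrite {1}[v]row_sum_delta /S mulr_suml.
apply: (big_ind2 (fun u r => N u <= r)) => [|u r u' r' ur ur'|i _].
- by rewrite (is_norm0 hN).
- by rewrite (le_trans (is_normD hN _ _)) // lerD.
- by rewrite (is_normZ hN) mulrC ler_wpM2l // (is_norm_ge0 hN).
Qed.

Lemma sub_abs_continuous (R : realType) n (a b c d : R) (u : R -> 'rV[R]_n) :
  a <= c -> d <= b -> abs_continuous a b u -> abs_continuous c d u.
Proof.
move=> ac db uac e /uac[g g0 H]; exists g => // k l r lr; apply: H => i.
by have [cl lri rd] := lr i; split; [exact: le_trans cl | | exact: le_trans db].
Qed.

Lemma abs_continuousB (R : realType) n (a b : R) (u v : R -> 'rV[R]_n) :
  abs_continuous a b u -> abs_continuous a b v ->
  abs_continuous a b (fun t => u t - v t).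
Proof.
move=> uac vac e e0.
have e20 : 0 < e / 2 by lra.
have [d d0 H] := uac _ e20; have [d' d'0 H'] := vac _ e20.
exists (Num.min d d') => [|k l r lr disj]; first by rewrite lt_min d0.
rewrite lt_min => /andP[/(H _ _ _ lr disj) uk /(H' _ _ _ lr disj) vk].
apply: (@le_lt_trans _ _
  (\sum_i `|u (r i) - u (l i)| + \sum_i `|v (r i) - v (l i)|)); last lra.
rewrite -big_split; apply: ler_sum => i _ /=.
by rewrite opprD addrACA -opprD ler_normB.
Qed.

(** Boundedness passes to adjacent intervals, and near each point it follows from absolute
    continuity applied to a single short interval. *)
Lemma abs_continuous_bounded (R : realType) n (a b : R) (u : R -> 'rV[R]_n) :
  a <= b -> abs_continuous a b u ->
  exists B, forall t, a <= t <= b -> `|u t| <= B.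
Proof.
move=> ab uac.
pose Q r s := exists B, forall t, r <= t <= s -> `|u t| <= B.
apply: (@cousin _ Q) => // [r s t _ _ _ _ [B HB] [B' HB']|t /andP[at_ tb]].
  exists (Num.max B B') => q /andP[rq qt]; rewrite le_max.
  by have [qs|/ltW sq] := leP q s; [rewrite HB ?rq|rewrite HB' ?sq ?orbT].
have [d d0 H] := uac 1 ltr01; exists d => // r s ar rt ts sb tr st.
exists (`|u t| + 1) => q /andP[rq qs].
suff : `|u q - u t| <= 1.
  by move=> ?; rewrite -[u q](subrK (u t)) addrC (le_trans (ler_normD _ _))// lerD2l.
have lem p p' : a <= p -> p <= p' -> p' <= b -> p' - p < d -> `|u p' - u p| <= 1.
  move=> ap pp' p'b pd.
  have := H 1%N (fun=> p) (fun=> p'); rewrite !big_ord1 => Hp; apply/ltW/Hp => //.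
  by move=> i j _ _ _; rewrite !ord1.
have [qt|/ltW tq] := leP q t; last by apply: lem => //; lra.
by rewrite distrC; apply: lem => //; lra.
Qed.

(** * The mean value inequality *)

(** The straddle lemma: when [t] lies between [r] and [s], the error terms of the increments from
    [t] to each endpoint are proportional to lengths that add up to [s - r]. *)
Lemma is_derive_increment (R : realType) n (N : 'rV[R]_n -> R) (u : R -> 'rV[R]_n)
    (t : R) (v : 'rV[R]_n) (K eps : R) :
  is_norm N -> is_derive t 1 u v -> N v <= K -> 0 < eps ->
  exists2 g, 0 < g & forall r s, r <= t -> t <= s -> t - g < r -> s < t + g ->
    N (u s - u r) <= (K + eps) * (s - r).
Proof.
move=> hN [du <-] NvK eps0.
have [C C0 NC] := is_norm_le_sup hN.
have e0 : 0 < eps / C by rewrite divr_gt0.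
have [g /= g0 H] : \forall h \near 0^', 
    `|'D_1 u t - h^-1 *: ((u \o shift t) (h *: 1) - u t)| < eps / C.
  by move/cvgrPdist_lt : du; apply.
have increment h : `|h| < g -> N (u (h + t) - u t) <= (K + eps) * `|h|.
  have [->|h0] := eqVneq h 0.
    by rewrite add0r subrr (is_norm0 hN) normr0 mulr0.
  move=> hg; have := H h; rewrite /= sub0r normrN => /(_ hg h0).
  rewrite [h *: 1]mulr1 => /ltW close.
  have -> : u (h + t) - u t =
      h *: ('D_1 u t - ('D_1 u t - h^-1 *: (u (h + t) - u t))).
    by rewrite subKr scalerA divff // scale1r.
  rewrite (is_normZ hN) mulrC ler_wpM2r //.
  rewrite (le_trans (is_normD hN _ _)) // lerD // (is_normN _ hN).
  by rewrite (le_trans (NC _)) // mulrC -ler_pdivlMr.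
exists g => // r s rt ts gr sg.
have -> : u s - u r = (u s - u t) - (u r - u t) by rewrite opprB addrA subrK.
rewrite (le_trans (is_normD hN _ _)) // (is_normN _ hN).
have := increment (s - t); have := increment (r - t); rewrite !subrK.
rewrite ler0_norm ?subr_le0 // ger0_norm ?subr_ge0 // => rI sI.
have -> : (K + eps) * (s - r) = (K + eps) * (s - t) + (K + eps) * - (r - t) by ring.
by apply: lerD; [apply: sI|apply: rI]; lra.
Qed.

#[local] Instance lebesgue_ae_filter (R : realType) :
  Filter (almost_everywhere (@lebesgue_measure R)).
Proof. exact: (ae_filter_ringOfSetsType (@lebesgue_measure R)). Qed.

Lemma ae_open_cover (R : realType) (P : R -> Prop) (d : R) : 0 < d ->
  {ae lebesgue_measure, forall t : R, P t} ->
  exists U : set R, [/\ open U, (lebesgue_measure U < d%:E)%E &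
    forall t, ~ P t -> U t].
Proof.
move=> d0 [A' [mA' A'0 badA']].
pose A : set R := A'.
have mA : measurable A by exact: mA'.
have A0 : lebesgue_measure A = 0%E by exact: A'0.
have Aoo : (lebesgue_measure A < +oo)%E by rewrite A0.
have [U [openU AU UAd]] := lebesgue_regularity_outer mA Aoo d0.
exists U; split => // [|t Pt]; last exact/AU/badA'.
have mU : measurable U by exact: measurable_realfun.open_measurable.
(* Outer regularity bounds the measure of the difference of [U] and [A]; adding the null set [A]
   back costs nothing. *)
apply: le_lt_trans UAd.
rewrite -[X in (lebesgue_measure X <= _)%E](setDUK AU).
rewrite (le_trans (measureU2 _ _ _)) //; first exact: measurableD.
by rewrite [X in (X + _ <= _)%E](_ : _ = 0%E) ?add0e.
Qed.

(* Henstock's argument: subintervals tagged at a point of differentiability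
   contribute at most [(K + eps) * length]; the others lie in an open set of
   small measure covering the exceptional null set, so their total
   contribution is small by absolute continuity. *)
Lemma abs_continuous_mean_value (R : realType) n (N : 'rV[R]_n -> R) (a b K : R)
    (u : R -> 'rV[R]_n) :
  is_norm N -> 0 <= K -> a <= b -> abs_continuous a b u ->
  {ae lebesgue_measure, forall t : R, a <= t <= b ->
     exists2 v, is_derive t 1 u v & N v <= K} ->
  N (u b - u a) <= K * (b - a).
Proof.
move=> hN K0 ab uac uderiv.
have [C C0 NC] := is_norm_le_sup hN.
apply/ler_addgt0Pr => e e0.
(* Half of [e] pays for the good intervals, the other half for the bad ones. The added 1 avoids
   dividing by zero when [a = b]. *)
pose eps := e / (2 * (b - a + 1)).
have eps0 : 0 < eps by rewrite divr_gt0 //; lra.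
have e0' : 0 < e / (2 * C) by rewrite divr_gt0 // mulr_gt0.
have [d d0 uacd] := uac _ e0'.
have [U [openU Ud badU]] := ae_open_cover d0 uderiv.
(* The finite family collects the bad subintervals, whose increments are kept aside; concatenating
   families makes [Q] additive. *)
pose Q r s := exists k (l w : 'I_k -> R),
  [/\ (forall i, [/\ r <= l i, l i <= w i & w i <= s]),
      trivIset [set: 'I_k] (fun i => `]l i, w i[%classic),
      (forall i, `]l i, w i[%classic `<=` U) &
      N (u s - u r) <= (K + eps) * (s - r) + \sum_i C * `|u (w i) - u (l i)|].
have [k [l [w [lw disj lwU Nuba]]]] : Q a b.
  apply: cousin => // [r s t ar rs st tb|t /andP[at_ tb]].
    move=> [k [l [w [lw disj lwU H]]]] [k' [l' [w' [lw' disj' lwU' H']]]].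
    exists (k + k')%N.
    exists (fun i : 'I_(k + k') => match fintype.split i with inl j => l j | inr j => l' j end).
    exists (fun i : 'I_(k + k') => match fintype.split i with inl j => w j | inr j => w' j end).
    split.
    - move=> i; case: (fintype.split i) => j.
        by have [? ? ?] := lw j; split => //; lra.
      by have [? ? ?] := lw' j; split => //; lra.
    (* Intervals from different families lie on opposite sides of [s]. *)
    - move=> i j _ _; rewrite -(splitK i) -(splitK j) !unsplitK.
      case: (fintype.split i) => i'; case: (fintype.split j) => j' /= [y [/=]].
      + by move=> yi yj; rewrite (disj i' j') //; exists y.
      + rewrite !in_itv /=; have [? ? ?] := lw i'; have [? ? ?] := lw' j'.
        by move=> /andP[? ?] /andP[? ?]; exfalso; lra.
      + rewrite !in_itv /=; have [? ? ?] := lw' i'; have [? ? ?] := lw j'.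
        by move=> /andP[? ?] /andP[? ?]; exfalso; lra.
      + by move=> yi yj; rewrite (disj' i' j') //; exists y.
    - by move=> i; case: (fintype.split i).
    - rewrite big_split_ord /=.
      under eq_bigr do rewrite -[lshift _ _]/(unsplit (inl _)) unsplitK.
      under [X in _ + (_ + X)]eq_bigr do
        rewrite -[rshift _ _]/(unsplit (inr _)) unsplitK.
      have -> : u t - u r = (u t - u s) + (u s - u r) by rewrite addrA subrK.
      have := is_normD hN (u t - u s) (u s - u r).
      set S := \sum_i _ in H *; set S' := \sum_i _ in H' *.
      lra.
  (* A tag with a bounded derivative needs no bad interval; at any other tag the whole interval is
     the single bad one, small enough to lie in [U]. *)
  have [[v dv NvK]|bad] := pselect (exists2 v, is_derive t 1 u v & N v <= K).
    have [g g0 H] := is_derive_increment hN dv NvK eps0.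
    exists g => // r s _ rt ts _ tr st.
    exists 0%N, (fun=> 0), (fun=> 0); split; try by case.
    by rewrite big_ord0 addr0; exact: H.
  have Ut : U t by apply: badU => /(_ _)/wrap[]; rewrite ?at_.
  have [g /= g0 H] := openU _ Ut.
  exists g => // r s _ rt ts _ tr st.
  exists 1%N, (fun=> r), (fun=> s); split.
  - by move=> _; split => //; exact: le_trans ts.
  - by move=> i j _ _ _; rewrite !ord1.
  - move=> _ y; rewrite /= in_itv /= => /andP[ry ys]; apply: H.
    by rewrite /= ltr_norml; lra.
  - rewrite big_ord1; apply: (le_trans (NC _)).
    by rewrite lerDr mulr_ge0 ?subr_ge0 ?(le_trans rt) ?addr_ge0 // ltW.
(* By disjointness the total length is the measure of a union contained in [U]. *)
have sum_lt : \sum_i (w i - l i) < d.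
  rewrite -lte_fin -sumEFin; apply: le_lt_trans Ud.
  have -> : (\sum_(i < k) (w i - l i)%:E =
      \sum_(i < k) lebesgue_measure `]l i, w i[%classic)%E.
    apply: eq_bigr => i _; rewrite lebesgue_measure_itv /= lte_fin.
    have [_ + _] := lw i; rewrite le_eqVlt => /predU1P[->|-> //].
    by rewrite ltxx subrr.
  rewrite -measure_bigsetU_ord //.
  apply: le_measure; rewrite ?inE //.
  - by apply: bigsetU_measurable => i _.
  - exact: measurable_realfun.open_measurable.
  - by elim/big_ind: _ => // V W VU WU; rewrite subUset.
have := uacd _ _ _ lw disj sum_lt.
rewrite ltr_pdivlMr ?mulr_gt0 // => small.
rewrite (le_trans Nuba) // -mulr_sumr.
have : eps * (b - a) <= e / 2.
  have -> : e / 2 = eps * (b - a + 1) by rewrite /eps; field; lra.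
  by rewrite ler_pM2l //; lra.
lra.
Qed.

(** * A discrete Gronwall estimate *)

(** The supremum [S] of [N (u t)] between [p] and [q] bounds the derivative by [L * S + eta], so the
    mean value inequality bounds [S] by itself with factor 1/2. Adding [eta / L] to both sides
    leaves a pure factor 2, ready for iteration. *)
Lemma gronwall_step (R : realType) n (N : 'rV[R]_n -> R) (a b L eta p q : R)
    (u : R -> 'rV[R]_n) :
  is_norm N -> 0 < L -> 0 <= eta -> abs_continuous a b u ->
  {ae lebesgue_measure, forall t : R, a <= t <= b ->
     exists2 v, is_derive t 1 u v & N v <= L * N (u t) + eta} ->
  a <= p <= b -> a <= q <= b -> `|q - p| * (2 * L) <= 1 ->
  N (u q) + eta / L <= 2 * (N (u p) + eta / L).
Proof.
move=> hN L0 eta0 uac uderiv /andP[ap pb] /andP[aq qb] qp.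
pose c := Num.min p q; pose d := Num.max p q.
have ac : a <= c by rewrite le_min ap.
have db : d <= b by rewrite ge_max pb.
have [cp cq] : c <= p /\ c <= q by rewrite !ge_min !lexx orbT.
have [pd qd] : p <= d /\ q <= d by rewrite !le_max !lexx orbT.
have dc : d - c = `|q - p|.
  by rewrite /c /d; case: (leP p q) => [?|?]; [rewrite ger0_norm|rewrite ltr0_norm]; lra.
have [C C0 NC] := is_norm_le_sup hN.
have [B HB] := abs_continuous_bounded (le_trans ap pb) uac.
pose V : set R := [set N (u t) | t in [set t | c <= t <= d]].
have ubV : ubound V (C * B).
  move=> _ [t /andP[ct td] <-]; rewrite (le_trans (NC _)) // ler_pM2l //.
  by apply: HB; apply/andP; split; lra.
have V0 : V !=set0 by exists (N (u p)), p => //=; rewrite cp.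
pose S := sup V.
have leS t : c <= t <= d -> N (u t) <= S.
  by move=> ctd; apply: ub_le_sup; [exists (C * B)|exists t].
have S0 : 0 <= S by rewrite (le_trans (is_norm_ge0 hN (u p))) // leS // cp.
have K0 : 0 <= L * S + eta by rewrite addr_ge0 // mulr_ge0 // ltW.
have mean r s : c <= r -> r <= s -> s <= d ->
    N (u s - u r) <= (L * S + eta) * (s - r).
  move=> cr rs sd; apply: (abs_continuous_mean_value (u := u) hN K0 rs).
    by apply: (@sub_abs_continuous _ _ a b) uac; lra.
  apply: filterS uderiv => t H /andP[rt ts].
  have [|v dv Nv] := H; first by apply/andP; split; lra.
  exists v => //; apply: (le_trans Nv); rewrite lerD2r ler_pM2l //.
  by rewrite leS //; apply/andP; split; lra.
have inc t : c <= t <= d -> N (u t - u p) <= (L * S + eta) * (d - c).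
  move=> /andP[ct td]; have [pt|/ltW tp] := leP p t.
    by rewrite (le_trans (mean _ _ cp pt td)) // ler_wpM2l //; lra.
  rewrite -(is_normN _ hN) opprB (le_trans (mean _ _ ct tp pd)) // ler_wpM2l //; lra.
have half : (L * S + eta) * (d - c) <= (S + eta / L) / 2.
  have -> : (S + eta / L) / 2 = (L * S + eta) * (2 * L)^-1 by field; lra.
  by rewrite ler_wpM2l // dc -[leRHS]mul1r ler_pdivlMr // mulr_gt0.
(* Since [S] is finite, its half on the right can be absorbed into the left side. *)
have SS : S <= N (u p) + (S + eta / L) / 2.
  apply: ge_sup => // _ [t ctd <-].
  rewrite -[u t](subrK (u p)) (le_trans (is_normD hN _ _)) // addrC lerD2l.
  exact: le_trans (inc _ ctd) half.
have := leS q; rewrite cq qd => /(_ isT); lra.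
Qed.

Lemma gronwall_iter (R : realType) n (N : 'rV[R]_n -> R) (a b L eta t0 : R)
    (u : R -> 'rV[R]_n) :
  is_norm N -> 0 < L -> 0 <= eta -> abs_continuous a b u ->
  {ae lebesgue_measure, forall t : R, a <= t <= b ->
     exists2 v, is_derive t 1 u v & N v <= L * N (u t) + eta} ->
  a <= t0 <= b ->
  forall k t, a <= t <= b -> `|t - t0| * (2 * L) <= k%:R ->
  N (u t) + eta / L <= 2 ^+ k * (N (u t0) + eta / L).
Proof.
move=> hN L0 eta0 uac uderiv abt0; elim=> [|k IH] t abt.
  rewrite pmulr_lle0 ?mulr_gt0 // normr_le0 subr_eq0 => /eqP ->.
  by rewrite expr0 mul1r.
(* Cutting the segment from [t0] to [t] at the fraction [theta] leaves [k] steps for the induction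
   hypothesis up to [p] and exactly one step from [p] to [t]. *)
move=> tk; pose theta : R := k%:R / k.+1%:R.
have k1 : (0 : R) < k.+1%:R by rewrite ltr0n.
have theta0 : 0 <= theta by rewrite divr_ge0.
have theta1 : 0 <= 1 - theta by rewrite subr_ge0 ler_pdivrMr // mul1r ler_nat.
have thetak : theta * k.+1%:R = k%:R by rewrite divfK // gt_eqF.
pose p := t0 + theta * (t - t0).
have abp : a <= p <= b.
  case/andP: abt0 => a0 b0; case/andP: abt => at_ tb.
  have -> : p = (1 - theta) * t0 + theta * t by rewrite /p; ring.
  by apply/andP; split; nra.
have pt0 : N (u p) + eta / L <= 2 ^+ k * (N (u t0) + eta / L).
  apply: IH => //; rewrite /p addrC addKr normrM ger0_norm // -mulrA -thetak.
  by rewrite ler_wpM2l.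
have := gronwall_step hN L0 eta0 uac uderiv abp abt.
have -> : t - p = (1 - theta) * (t - t0) by rewrite /p; ring.
rewrite normrM ger0_norm // -mulrA => /(_ _)/wrap[].
  rewrite (le_trans (ler_wpM2l theta1 tk)) // mulrBl mul1r thetak.
  by rewrite -natr1 addrC addKr.
by move=> /le_trans; apply; rewrite exprS -mulrA ler_pM2l.
Qed.

Unset Implicit Arguments.

(** * Comparison of solutions for two parameters *)

Theorem theorem2p2 (R : realType) (n m : nat)
  (normn : 'rV[R]_n -> R) (normm : 'rV[R]_m -> R)
  (hnormn : is_norm normn) (hnormm : is_norm normm)
  (I : set R) (X : set 'rV[R]_n) (M : set 'rV[R]_m)
  (openI : open I) (intervalI : is_interval I)
  (openX : open X) (connectedX : connected X)
  (openM : open M) (connectedM : connected M)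
  (t0 : R) (It0 : I t0) (x0 : 'rV[R]_n) (Xx0 : X x0)
  (f : R -> 'rV[R]_n -> 'rV[R]_m -> 'rV[R]_n)
  (f_measurable : jointly_measurable I X M f)
  (f_continuous : forall t, I t ->
     {within X `*` M, continuous (fun p : 'rV[R]_n * 'rV[R]_m => f t p.1 p.2)})
  (f_bounded : exists2 g : R -> R, locally_summable I g &
     forall t x mu, I t -> X x -> M mu -> normn (f t x mu) <= g t)
  (f_lipschitz : exists L : R,
     {ae lebesgue_measure, forall t : R, I t ->
        forall mu, M mu -> forall x1 x2, X x1 -> X x2 ->
          normn (f t x1 mu - f t x2 mu) <= L * normn (x1 - x2)})
  (f_equicontinuous : forall e : R, 0 < e -> exists2 d : R, 0 < d &
     forall t x, I t -> X x -> forall mu1 mu2, M mu1 -> M mu2 ->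
       normm (mu1 - mu2) < d -> normn (f t x mu1 - f t x mu2) < e)
  (a b : R) (abI : `[a, b]%classic `<=` I) (abt0 : a <= t0 <= b)
  (x : R -> 'rV[R]_m -> 'rV[R]_n)
  (x_solution : forall mu, M mu ->
     is_solution X (fun t y => f t y mu) t0 x0 a b (fun t => x t mu))
  (x_unique : forall mu, M mu -> forall y : R -> 'rV[R]_n,
     is_solution X (fun t y => f t y mu) t0 x0 a b y ->
     forall t, a <= t <= b -> y t = x t mu) :
  forall e : R, 0 < e -> exists2 d : R, 0 < d &
    forall t, a <= t <= b -> forall mu1 mu2, M mu1 -> M mu2 ->
      normm (mu1 - mu2) < d -> normn (x t mu1 - x t mu2) < e.
Proof.
move=> e e0.
(* The given constant may be zero or negative; enlarging it makes division by [L] possible. *)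
have [L0 lip] := f_lipschitz; pose L := Num.max 1 L0.
have L_gt0 : 0 < L by rewrite lt_max ltr01.
(* This many steps reach every point of the interval from [t0], whatever the parameters; [eta] is
   then chosen so that [2 ^+ k * (eta / L) = e]. *)
pose k := Num.bound ((b - a) * (2 * L)).
have pow0 : (0 : R) < 2 ^+ k by rewrite exprn_gt0.
pose eta := e * L / 2 ^+ k.
have eta0 : 0 < eta by rewrite divr_gt0 // mulr_gt0.
have [d d0 fd] := f_equicontinuous _ eta0.
exists d => // t abt mu1 mu2 M1 M2 mud.
have [X1 ac1 der1 init1] := x_solution _ M1.
have [X2 ac2 der2 init2] := x_solution _ M2.
pose u s := x s mu1 - x s mu2.
have uac : abs_continuous a b u by exact: abs_continuousB.
have uderiv : {ae lebesgue_measure, forall s : R, a <= s <= b ->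
    exists2 v, is_derive s 1 u v & normn v <= L * normn (u s) + eta}.
  apply: filterS3 lip der1 der2 => s lips d1 d2 abs.
  have Is : I s by apply: abI; rewrite /= in_itv.
  exists (f s (x s mu1) mu1 - f s (x s mu2) mu2).
    by apply: is_deriveB; [exact: d1|exact: d2].
  (* The intermediate value separates a change of state, handled by the Lipschitz condition, from a
     change of parameter, handled by equicontinuity. *)
  rewrite -[X in normn X](subrKA (f s (x s mu2) mu1)).
  rewrite (le_trans (is_normD hnormn _ _)) // lerD //.
    rewrite (le_trans (lips Is _ M1 _ _ (X1 _ abs) (X2 _ abs))) //.
    by rewrite ler_wpM2r ?(is_norm_ge0 hnormn) // le_max lexx orbT.
  by apply/ltW/fd => //; exact: X2.
have := gronwall_iter hnormn L_gt0 (ltW eta0) uac uderiv abt0 (k := k) abt.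
have -> : u t0 = 0 by rewrite /u init1 init2 subrr.
rewrite (is_norm0 hnormn) add0r => /(_ _)/wrap[].
  have ab : 0 <= (b - a) * (2 * L).
    rewrite pmulr_lge0 ?mulr_gt0 // subr_ge0.
    by case/andP: abt => at_; exact: le_trans.
  rewrite (le_trans _ (ltW (archi_boundP ab))) // ler_pM2r ?mulr_gt0 //.
  by case/andP: abt => at_ tb; case/andP: abt0 => a0 b0; rewrite ler_norml; lra.
have -> : 2 ^+ k * (eta / L) = e by rewrite /eta; field; rewrite !gt_eqF.
(* The strict inequality comes from dropping the positive term [eta / L] on the left. *)
by apply: lt_le_trans; rewrite ltrDl divr_gt0.
Qed.
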